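(* Let $A=(a_{ij})\in\mathbb{R}^{m\times n}$ and let $R(\cdot)$ denote the rank of a real matrix. Then: (i) The zero vector $\boldsymbol{\tilde 0}=(\tilde 0,\dots,\tilde 0)^T\in\mathcal{X}^n$ is a solution of $A\boldsymbol{\tilde x}=\boldsymbol{\tilde 0}$. (ii) $A\boldsymbol{\tilde x}=\boldsymbol{\tilde 0}$ has a nontrivial solution, i.e. a solution $\boldsymbol{\tilde x}\in\mathcal{X}^n$ with $\boldsymbol{\tilde x}\ne\boldsymbol{\tilde 0}$, if and only if $R(A)<n$. (iii) Let $\boldsymbol{\tilde b}=(\tilde b_1,\dots,\tilde b_m)^T\in\mathcal{X}^m$ with $\tilde b_i=\langle b_i;d_{b_i}^-,d_{b_i}^+,\mu_{b_i}^-,\mu_{b_i}^+\rangle$. The system $A\boldsymbol{\tilde x}=\boldsymbol{\tilde b}$ is consistent (has at least one solution $\boldsymbol{\tilde x}\in\mathcal{X}^n$) if and only if $R(A)=R(A\;\boldsymbol{\tilde b}_{\mathbf{X}})$, where $(A\;\boldsymbol{\tilde b}_{\mathbf{X}})$ is the $m\times(n+5)$ augmented real matrix with $$\boldsymbol{\tilde b}_{\mathbf{X}}=\begin{pmatrix} b_1&\ln d_{b_1}^-&\ln d_{b_1}^+&\mu_{b_1}^-&\mu_{b_1}^+\\ b_2&\ln d_{b_2}^-&\ln d_{b_2}^+&\mu_{b_2}^-&\mu_{b_2}^+\\ \vdots&\vdots&\vdots&\vdots&\vdots\\ b_m&\ln d_{b_m}^-&\ln d_{b_m}^+&\mu_{b_m}^-&\mu_{b_m}^+\end{pmatrix}.$$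 Furthermore, when the system is consistent, the solution is unique if $R(A)=n$, and there are infinitely many solutions if $R(A)<n$.
   Context: Gaussian-PDMF space $\mathcal{X}$: the set of functions $f:\mathbb{R}\to[0,1]$ with parameters $x\in\mathbb{R}$, $d^-,d^+>0$, $\mu^-,\mu^+\in\mathbb{R}$, given by $f(x)=1$, $f(\tau)=0$ for $\tau\le x-d^-$ or $\tau\ge x+d^+$, $f(\tau)=\int_{-\infty}^{\tan(\frac{\pi}{d^-}(\tau-x+d^-)-\frac{\pi}{2})}\frac{1}{\sqrt{2\pi}}e^{-\frac12(t-\mu^-)^2}dt$ for $\tau\in(x-d^-,x)$, and $f(\tau)=\int_{-\infty}^{\tan(\frac{\pi}{d^+}(x+d^+-\tau)-\frac{\pi}{2})}\frac{1}{\sqrt{2\pi}}e^{-\frac12(t-\mu^+)^2}dt$ for $\tau\in(x,x+d^+)$. Such an element is identified with its parameter tuple, written $\tilde x=\langle x;d^-,d^+,\mu^-,\mu^+\rangle$; two elements are equal iff all five parameters coincide. Operations on $\mathcal{X}$, for $\tilde x_i=\langle x_i;d_i^-,d_i^+,\mu_i^-,\mu_i^+\rangle$ and $\lambda\in\mathbb{R}$: $\tilde x_1+\tilde x_2=\langle x_1+x_2;d_1^-d_2^-,d_1^+d_2^+,\mu_1^-+\mu_2^-,\mu_1^++\mu_2^+\rangle$; $\lambda\tilde x=\langle\lambda x;(d^-)^\lambda,(d^+)^\lambda,\lambda\mu^-,\lambda\mu^+\rangle$. With these operations $\mathcal{X}$ is a real vector space with zero element $\tilde 0=\langle 0;1,1,0,0\rangle$.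 For $A=(a_{ij})\in\mathbb{R}^{m\times n}$ and $\boldsymbol{\tilde x}=(\tilde x_1,\dots,\tilde x_n)^T\in\mathcal{X}^n$, $A\boldsymbol{\tilde x}\in\mathcal{X}^m$ is the vector with $i$-th entry $\sum_{k=1}^n a_{ik}\tilde x_k$. *)

(* Defs.v *)
From HB Require Import structures.
From mathcomp Require Import all_boot all_order all_algebra ring lra.
From mathcomp Require Import all_classical all_reals all_analysis.
From mathcomp Require Import measurable_realfun.

Set Implicit Arguments.
Unset Strict Implicit.
Unset Printing Implicit Defensive.

Import Order.TTheory GRing.Theory Num.Theory.
Import numFieldNormedType.Exports.

Local Open Scope classical_set_scope.
Local Open Scope ring_scope.

(* The tuple <x; d^-, d^+, mu^-, mu^+> of a Gaussian-PDMF. An element of the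
   space is its parameter tuple; the membership function is [gpdmf_fun], and
   [gpdmf_fun_inj] shows that it determines the five parameters. *)
Record gpdmf (R : realType) := Gpdmf {
  gpx : R;
  gpdm : {posnum R};
  gpdp : {posnum R};
  gpmm : R;
  gpmp : R
}.

Definition gauss_cdf (R : realType) (m a : R) : R :=
  \int[lebesgue_measure]_(t in `]-oo, a])
    ((Num.sqrt (2 * pi))^-1 * expR (- 2^-1 * (t - m) ^+ 2)).

(* The last two branches are x - d^- < tau < x and x < tau < x + d^+. *)
Definition gpdmf_fun (R : realType) (p : gpdmf R) (tau : R) : R :=
  let x := gpx p in let dm := (gpdm p)%:num in let dp := (gpdp p)%:num in
  if tau == x then 1
  else if (tau <= x - dm) || (x + dp <= tau) then 0
  else if tau < x
    then gauss_cdf (gpmm p) (tan (pi / dm * (tau - x + dm) - pi / 2))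
    else gauss_cdf (gpmp p) (tan (pi / dp * (x + dp - tau) - pi / 2)).

Section gauss_cdf_theory.
Context {R : realType}.
Implicit Types m a : R.

Let mu := @lebesgue_measure R.

Let gauss_pdfE m t :
  (Num.sqrt (2 * pi))^-1 * expR (- 2^-1 * (t - m) ^+ 2) = normal_pdf m 1 t.
Proof.
rewrite normal_pdfE ?oner_eq0// /normal_peak /normal_fun expr1n mul1r.
by rewrite mulr_natl; congr (_ * expR _); field.
Qed.

Lemma gauss_cdfE m a :
  gauss_cdf m a = (\int[mu]_(t in [set` `]-oo, a]]) normal_pdf m 1 t)%R.
Proof. by apply: eq_Rintegral => t _; exact: gauss_pdfE. Qed.

Lemma gauss_cdf_derive m a :
  derivable (gauss_cdf m) a 1 /\ (gauss_cdf m)^`()%classic a = normal_pdf m 1 a.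
Proof.
rewrite (_ : gauss_cdf m = fun y =>
  (\int[mu]_(t in [set` `]-oo, y]]) normal_pdf m 1 t)%R); last first.
  by apply/funext => y; exact: gauss_cdfE.
apply: (@continuous_FTC1 _ _ _ _ (a + 1)).
- by rewrite ltrDl.
- apply: (integrableS _ _ (subsetT _)) => //; exact: integrable_normal_pdf.
- by rewrite ltNyr.
- by apply: continuous_normal_pdf; rewrite oner_eq0.
Qed.

Lemma normal_pdf1_gt0 m t : 0 < normal_pdf m 1 t.
Proof.
by rewrite normal_pdfE ?oner_eq0// mulr_gt0 ?expR_gt0// normal_peak_gt0 ?oner_eq0.
Qed.

Lemma gauss_cdf_lt m : {homo gauss_cdf m : a b / a < b}.
Proof.
move=> a b ab.
apply: (@gtr0_derive1_incr _ _ a b) => //.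
- by move=> x _; have [] := gauss_cdf_derive m x.
- by move=> x _; have [_ ->] := gauss_cdf_derive m x; exact: normal_pdf1_gt0.
- apply: continuous_subspaceT => x; apply: differentiable_continuous.
  by apply/derivable1_diffP; have [] := gauss_cdf_derive m x.
Qed.

Lemma gauss_cdf_ge0 m a : 0 <= gauss_cdf m a.
Proof.
by rewrite gauss_cdfE; apply: Rintegral_ge0 => t _; exact: normal_pdf_ge0.
Qed.

Lemma gauss_cdf_le1 m a : gauss_cdf m a <= 1.
Proof.
rewrite gauss_cdfE /Rintegral.
have le1 : (\int[mu]_(t in [set` `]-oo, a]]) (normal_pdf m 1 t)%:E <= 1)%E.
  rewrite -(integral_normal_pdf m 1).
  apply: ge0_subset_integral => //.
  - by apply/measurable_EFinP; exact: measurable_normal_pdf.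
  - by move=> x _; rewrite lee_fin normal_pdf_ge0.
rewrite -lee_fin fineK// ge0_fin_numE; first exact: le_lt_trans le1 (ltry _).
by apply: integral_ge0 => x _; rewrite lee_fin normal_pdf_ge0.
Qed.

Lemma gauss_cdf_gt0 m a : 0 < gauss_cdf m a.
Proof.
apply: le_lt_trans (gauss_cdf_ge0 m (a - 1)) _.
by apply: gauss_cdf_lt; rewrite ltrBlDr ltrDl.
Qed.

Lemma gauss_cdf_lt1 m a : gauss_cdf m a < 1.
Proof.
apply: lt_le_trans (gauss_cdf_le1 m (a + 1)).
by apply: gauss_cdf_lt; rewrite ltrDl.
Qed.

Lemma gauss_cdf_inj m1 m2 : gauss_cdf m1 = gauss_cdf m2 -> m1 = m2.
Proof.
move=> eqG; have := (gauss_cdf_derive m1 m1).2.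
rewrite eqG (gauss_cdf_derive m2 m1).2 -!gauss_pdfE.
have /mulfI H : (Num.sqrt (2 * pi))^-1 != 0 :> R.
  apply/invr_neq0/lt0r_neq0; rewrite sqrtr_gt0.
  by apply: mulr_gt0; [|exact: pi_gt0].
move=> /H /expR_inj /eqP; rewrite subrr expr0n mulr0 mulf_eq0.
rewrite oppr_eq0 invr_eq0 (pnatr_eq0 _ 2) sqrf_eq0 subr_eq0.
by move=> /eqP.
Qed.

End gauss_cdf_theory.

Section gpdmf_fun_theory.
Context {R : realType}.
Implicit Types p q : gpdmf R.

Lemma gpdmf_fun_ge0_le1 p tau : 0 <= gpdmf_fun p tau <= 1.
Proof.
rewrite /gpdmf_fun; case: ifP => _; first by rewrite ler01 lexx.
case: ifP => _; first by rewrite lexx ler01.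
by case: ifP => _; rewrite gauss_cdf_ge0 gauss_cdf_le1.
Qed.

Let fun_eq1 p tau : (gpdmf_fun p tau == 1) = (tau == gpx p).
Proof.
rewrite /gpdmf_fun; case: ifP => _; first by rewrite eqxx.
case: ifP => _; first by rewrite eq_sym oner_eq0.
by case: ifP => _; rewrite lt_eqF// gauss_cdf_lt1.
Qed.

Let fun_eq0 p tau : (gpdmf_fun p tau == 0) =
  (tau <= gpx p - (gpdm p)%:num) || (gpx p + (gpdp p)%:num <= tau).
Proof.
rewrite /gpdmf_fun; case: ifP => [/eqP ->|_].
  rewrite oner_eq0; symmetry; apply/negbTE; rewrite negb_or -!ltNge.
  by rewrite ltrBlDr !ltrDl !gt0.
case: ifP => _; first by rewrite eqxx.
by case: ifP => _; rewrite gt_eqF// gauss_cdf_gt0.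
Qed.

Let dm_le p q : gpdmf_fun p = gpdmf_fun q -> gpx p = gpx q ->
  (gpdm q)%:num <= (gpdm p)%:num :> R.
Proof.
move=> pq xE; have := fun_eq0 p (gpx p - (gpdm p)%:num).
rewrite lexx pq fun_eq0 -xE => /orP[|]; first by rewrite lerD2l lerN2.
by rewrite lerD2l => /(lt_le_trans (gt0 (gpdp q))); rewrite oppr_gt0 ltNge ge0.
Qed.

Let dp_le p q : gpdmf_fun p = gpdmf_fun q -> gpx p = gpx q ->
  (gpdp q)%:num <= (gpdp p)%:num :> R.
Proof.
move=> pq xE; have := fun_eq0 p (gpx p + (gpdp p)%:num).
rewrite lexx orbT pq fun_eq0 -xE => /orP[|]; last by rewrite lerD2l.
by rewrite lerD2l => /(lt_le_trans (gt0 (gpdp p))); rewrite oppr_gt0 ltNge ge0.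
Qed.

Let fun_left p (s : R) : 0 < s < (gpdm p)%:num ->
  gpdmf_fun p (gpx p - (gpdm p)%:num + s) =
  gauss_cdf (gpmm p) (tan (pi / (gpdm p)%:num * s - pi / 2)).
Proof.
have : 0 < (gpdp p)%:num :> R by [].
have : 0 < (gpdm p)%:num :> R by [].
rewrite /gpdmf_fun.
case: p => x [d dP] [e eP] ? ? /=; rewrite {dP eP} => d0 e0 /andP[s0 sd].
rewrite ifF; last by apply/negbTE/eqP; lra.
rewrite ifF; last by apply/negbTE; rewrite negb_or -!ltNge; apply/andP; split; lra.
rewrite ifT; last lra.
by have -> : x - d + s - x + d = s by ring.
Qed.

Let fun_right p (s : R) : 0 < s < (gpdp p)%:num ->
  gpdmf_fun p (gpx p + (gpdp p)%:num - s) =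
  gauss_cdf (gpmp p) (tan (pi / (gpdp p)%:num * s - pi / 2)).
Proof.
have : 0 < (gpdp p)%:num :> R by [].
have : 0 < (gpdm p)%:num :> R by [].
rewrite /gpdmf_fun.
case: p => x [d dP] [e eP] ? ? /=; rewrite {dP eP} => d0 e0 /andP[s0 sd].
rewrite ifF; last by apply/negbTE/eqP; lra.
rewrite ifF; last by apply/negbTE; rewrite negb_or -!ltNge; apply/andP; split; lra.
rewrite ifF; last by apply/negbTE; rewrite -leNgt; lra.
by have -> : x + e - (x + e - s) = s by ring.
Qed.

(* Every real number is reached by the argument of tan on each branch. *)
Let tau_of (d a : R) : 0 < d -> exists2 s : R, 0 < s < d &
  tan (pi / d * s - pi / 2) = a.
Proof.
move=> d0; have pi0 := pi_gt0 R.
exists (d / pi * (atan a + pi / 2)); last first.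
  rewrite -[RHS]atanK; congr tan; move: (atan a) (pi : R) pi0 => u v v0.
  by field; rewrite !gt_eqF.
have := atan_gtNpi2 a; have := atan_ltpi2 a.
move: (atan a) (pi : R) pi0 => u v v0 h1 h2.
apply/andP; split; first by rewrite mulr_gt0 ?divr_gt0//; lra.
by rewrite -mulrA gtr_pMr// mulrC ltr_pdivrMr//; lra.
Qed.

Lemma gpdmf_fun_inj : injective (@gpdmf_fun R).
Proof.
move=> p q pq.
have xE : gpx p = gpx q by apply/eqP; rewrite -fun_eq1 -pq fun_eq1.
have dmE : gpdm p = gpdm q.
  by apply/val_inj/le_anti; rewrite (dm_le pq xE) (dm_le (esym pq) (esym xE)).
have dpE : gpdp p = gpdp q.
  by apply/val_inj/le_anti; rewrite (dp_le pq xE) (dp_le (esym pq) (esym xE)).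
have mmE : gpmm p = gpmm q.
  apply/gauss_cdf_inj/funext => a.
  have d0 : 0 < (gpdm p)%:num :> R by [].
  have [s sd <-] := tau_of a d0.
  have sq : 0 < s < (gpdm q)%:num by rewrite -dmE.
  by have := fun_left sq; rewrite -dmE -xE -pq (fun_left sd).
have mpE : gpmp p = gpmp q.
  apply/gauss_cdf_inj/funext => a.
  have d0 : 0 < (gpdp p)%:num :> R by [].
  have [s sd <-] := tau_of a d0.
  have sq : 0 < s < (gpdp q)%:num by rewrite -dpE.
  by have := fun_right sq; rewrite -dpE -xE -pq (fun_right sd).
by case: p q xE dmE dpE mmE mpE {pq} => ? ? ? ? ? [? ? ? ? ?] /= -> -> -> -> ->.
Qed.

End gpdmf_fun_theory.

HB.instance Definition _ (R : realType) := gen_eqMixin (gpdmf R).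
HB.instance Definition _ (R : realType) := gen_choiceMixin (gpdmf R).

Definition gpdmf_zero (R : realType) : gpdmf R := Gpdmf 0 1%:pos 1%:pos 0 0.

Definition gpdmf_add (R : realType) (p q : gpdmf R) : gpdmf R :=
  Gpdmf (gpx p + gpx q)
    ((gpdm p)%:num * (gpdm q)%:num)%:pos ((gpdp p)%:num * (gpdp q)%:num)%:pos
    (gpmm p + gpmm q) (gpmp p + gpmp q).

Definition gpdmf_scale (R : realType) (l : R) (p : gpdmf R) : gpdmf R :=
  Gpdmf (l * gpx p)
    ((gpdm p)%:num `^ l)%:pos ((gpdp p)%:num `^ l)%:pos
    (l * gpmm p) (l * gpmp p).

Definition gpdmf_opp (R : realType) (p : gpdmf R) : gpdmf R :=
  gpdmf_scale (-1) p.

Section gpdmf_vector_space.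
Context {R : realType}.
Implicit Types (p q : gpdmf R) (a b : R).

Lemma gpdmf_eq p q : gpx p = gpx q ->
  (gpdm p)%:num = (gpdm q)%:num :> R -> (gpdp p)%:num = (gpdp q)%:num :> R ->
  gpmm p = gpmm q -> gpmp p = gpmp q -> p = q.
Proof.
case: p q => [x dm dp mm mp] [x' dm' dp' mm' mp'] /=.
by move=> -> /val_inj -> /val_inj -> -> ->.
Qed.

Lemma gpdmf_addA : associative (@gpdmf_add R).
Proof. by move=> p q r; apply: gpdmf_eq; rewrite /= ?addrA ?mulrA. Qed.

Lemma gpdmf_addC : commutative (@gpdmf_add R).
Proof. by move=> p q; apply: gpdmf_eq; rewrite /= 1?addrC 1?mulrC. Qed.

Lemma gpdmf_add0 : left_id (@gpdmf_zero R) (@gpdmf_add R).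
Proof. by move=> p; apply: gpdmf_eq; rewrite /= ?add0r ?mul1r. Qed.

Lemma gpdmf_addN : left_inverse (@gpdmf_zero R) (@gpdmf_opp R) (@gpdmf_add R).
Proof.
by move=> p; apply: gpdmf_eq; rewrite /= ?mulN1r ?addNr// powR_inv1// mulVf.
Qed.

HB.instance Definition _ := GRing.isZmodule.Build (gpdmf R)
  gpdmf_addA gpdmf_addC gpdmf_add0 gpdmf_addN.

Lemma gpdmf_scaleA a b p :
  gpdmf_scale a (gpdmf_scale b p) = gpdmf_scale (a * b) p.
Proof. by apply: gpdmf_eq; rewrite /= ?mulrA// mulrC powRrM. Qed.

Lemma gpdmf_scale1 : left_id 1 (@gpdmf_scale R).
Proof. by move=> p; apply: gpdmf_eq; rewrite /= ?mul1r ?powRr1. Qed.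

Lemma gpdmf_scaleDr : right_distributive (@gpdmf_scale R) +%R.
Proof. by move=> a p q; apply: gpdmf_eq; rewrite /= ?mulrDr ?powRM. Qed.

Lemma gpdmf_scaleDl p : {morph (@gpdmf_scale R)^~ p : a b / a + b}.
Proof.
move=> a b; apply: gpdmf_eq; rewrite /= ?mulrDl// powRD//.
- by apply/implyP.
- by apply/implyP.
Qed.

HB.instance Definition _ := GRing.Zmodule_isLmodule.Build R (gpdmf R)
  gpdmf_scaleA gpdmf_scale1 gpdmf_scaleDr gpdmf_scaleDl.

End gpdmf_vector_space.

Definition gpdmf_mulmx (R : realType) (m n : nat)
    (A : 'M[R]_(m, n)) (x : 'cV[gpdmf R]_n) : 'cV[gpdmf R]_m :=
  \col_i \sum_(k < n) A i k *: x k 0.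

Definition gpdmf_coords (R : realType) (m : nat)
    (b : 'cV[gpdmf R]_m) : 'M[R]_(m, 5) :=
  \matrix_(i < m, j < 5)
    [:: gpx (b i 0); ln (gpdm (b i 0))%:num; ln (gpdp (b i 0))%:num;
        gpmm (b i 0); gpmp (b i 0)]`_j.

(* Main.v *)
Require Import Defs.
From mathcomp Require Import all_boot all_order all_algebra.
From mathcomp Require Import all_classical all_reals all_analysis.

Import Order.TTheory GRing.Theory Num.Theory.

(** The logarithm turns the two multiplicative parameters [d^-], [d^+] into
    additive ones, so [p |-> (x, ln d^-, ln d^+, mu^-, mu^+)] is a linear
    isomorphism from the space of Gaussian-PDMFs onto [R^5]. Applied entrywise it
    is a bijection [gpdmf_coords] from column vectors of Gaussian-PDMFs onto
    matrices with five columns, with inverse [gpdmf_of_coords], and it turns the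
    action of [A] into the ordinary product of matrices
    ([gpdmf_coords_mulmx]). The system [A x = b] is therefore equivalent to the
    matrix equation [A *m X = gpdmf_coords b] ([gpdmf_mulmx_eqE]).

    What remains is linear algebra over [R]: solvability is the equality of the
    ranks of [A] and of the augmented matrix ([mulmx_solvableP]), the map
    [X |-> A *m X] is injective when [A] has full column rank, and otherwise
    there is a nonzero [K] with [A *m K = 0] ([rank_lt_mulmx0]), in which case
    a solution [X] yields the pairwise distinct solutions [X + t *: K]. *)

Local Open Scope classical_set_scope.
Local Open Scope ring_scope.

(** Transposed, [A *m X = B] says that the rows of [B^T] lie in the row space
    of [A^T], that is, that adding them does not increase the rank. *)
Lemma mulmx_solvableP (F : fieldType) (m n p : nat)
    (A : 'M[F]_(m, n)) (B : 'M[F]_(m, p)) :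
  (exists X, A *m X = B) <-> \rank A = \rank (row_mx A B).
Proof.
rewrite -(mxrank_tr A) -(mxrank_tr (row_mx A B)) tr_row_mx -addsmxE.
have [_ eqR] := mxrank_leqif_sup (addsmxSl A^T B^T).
split=> [[X AX]|/eqP].
  by apply/eqP; rewrite eqR addsmx_sub submx_refl -AX trmx_mul submxMl.
rewrite eqR addsmx_sub => /andP[_ /submxP[D BD]].
by exists D^T; apply: trmx_inj; rewrite trmx_mul trmxK.
Qed.

Lemma rank_lt_mulmx0 (F : fieldType) (m n p : nat) (A : 'M[F]_(m, n)) :
  (\rank A < n)%N -> exists2 K : 'M[F]_(n, p.+1), A *m K = 0 & K != 0.
Proof.
move=> rA.
have /rowV0Pn[u /sub_kermxP uA u0] : kermx A^T != 0.
  by rewrite -mxrank_eq0 mxrank_ker mxrank_tr -lt0n subn_gt0.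
(* The first column is the kernel vector, the other columns vanish. *)
exists (u^T *m delta_mx 0 0).
  by rewrite mulmxA -[A]trmxK -trmx_mul uA trmx0 mul0mx.
apply: contraNneq u0 => K0; apply/eqP/rowP => i.
have := congr1 (fun K : 'M[F]_(n, p.+1) => K i 0) K0.
by rewrite !mxE big_ord1 !mxE !eqxx mulr1.
Qed.

Section coordinates.
Context {R : realType}.
Implicit Types p q : gpdmf R.

(** The coordinates of a single Gaussian-PDMF in [R^5]: a row of
    [gpdmf_coords]. *)
Definition gpdmf_coord p (j : 'I_5) : R :=
  [:: gpx p; ln (gpdm p)%:num; ln (gpdp p)%:num; gpmm p; gpmp p]`_j.

Lemma gpdmf_coord0 j : gpdmf_coord 0 j = 0.
Proof.
by case: j => -[|[|[|[|[|//]]]]] ? //; rewrite /gpdmf_coord /= ln1.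
Qed.

Lemma gpdmf_coordD j : {morph gpdmf_coord^~ j : p q / p + q}.
Proof.
by case: j => -[|[|[|[|[|//]]]]] ? p q //; rewrite /gpdmf_coord /= lnM ?posrE.
Qed.

Lemma gpdmf_coordZ j (a : R) : {morph gpdmf_coord^~ j : p / a *: p >-> a * p}.
Proof.
by case: j => -[|[|[|[|[|//]]]]] ? p //; rewrite /gpdmf_coord /= ln_powR.
Qed.

Lemma gpdmf_coords_mulmx m n (A : 'M[R]_(m, n)) (x : 'cV[gpdmf R]_n) :
  gpdmf_coords (gpdmf_mulmx A x) = A *m gpdmf_coords x.
Proof.
apply/matrixP => i j; rewrite !mxE -/(gpdmf_coord _ j).
rewrite (big_morph _ (gpdmf_coordD j) (gpdmf_coord0 j)).
by apply: eq_bigr => k _; rewrite gpdmf_coordZ mxE.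
Qed.

Lemma gpdmf_coords0 m : gpdmf_coords (0 : 'cV[gpdmf R]_m) = 0.
Proof. by apply/matrixP => i j; rewrite !mxE -[RHS](gpdmf_coord0 j). Qed.

(** The inverse of [gpdmf_coords]: exponentials restore the positive
    parameters. *)
Definition gpdmf_of_coords {m} (X : 'M[R]_(m, 5)) : 'cV[gpdmf R]_m :=
  \col_i Gpdmf (X i (inord 0))
    (PosNum (expR_gt0 (X i (inord 1)))) (PosNum (expR_gt0 (X i (inord 2))))
    (X i (inord 3)) (X i (inord 4)).

Lemma gpdmf_coordsK m : cancel (@gpdmf_coords R m) (@gpdmf_of_coords m).
Proof.
move=> x; apply/matrixP => i j; rewrite (ord1 j) mxE.
by apply: gpdmf_eq; rewrite /= mxE inordK//= lnK// posrE.
Qed.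

Lemma gpdmf_of_coordsK m : cancel (@gpdmf_of_coords m) (@gpdmf_coords R m).
Proof.
move=> X; apply/matrixP => i j; rewrite !mxE.
rewrite -[in RHS](inord_val j).
by case: j => -[|[|[|[|[|//]]]]] ? //=; rewrite expRK.
Qed.

Lemma gpdmf_mulmx_eqE m n (A : 'M[R]_(m, n)) x b :
  gpdmf_mulmx A x = b <-> A *m gpdmf_coords x = gpdmf_coords b.
Proof.
rewrite -gpdmf_coords_mulmx; split=> [->//|].
exact: (can_inj (@gpdmf_coordsK m)).
Qed.

End coordinates.

Theorem theorem3p2 (R : realType) (m n : nat) (A : 'M[R]_(m, n)) :
  [/\ gpdmf_mulmx A 0 = 0,
      (exists x : 'cV[gpdmf R]_n, gpdmf_mulmx A x = 0 /\ x <> 0)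
        <-> (\rank A < n)%N
    & forall b : 'cV[gpdmf R]_m,
      [/\ (exists x : 'cV[gpdmf R]_n, gpdmf_mulmx A x = b)
            <-> \rank A = \rank (row_mx A (gpdmf_coords b)),
          (exists x : 'cV[gpdmf R]_n, gpdmf_mulmx A x = b) ->
            \rank A = n -> exists! x : 'cV[gpdmf R]_n, gpdmf_mulmx A x = b
        & (exists x : 'cV[gpdmf R]_n, gpdmf_mulmx A x = b) ->
            (\rank A < n)%N ->
            infinite_set [set x : 'cV[gpdmf R]_n | gpdmf_mulmx A x = b]]].
Proof.
have A0 : gpdmf_mulmx A 0 = 0.
  by apply/gpdmf_mulmx_eqE; rewrite !gpdmf_coords0 mulmx0.
have uniqA x y : \rank A = n -> gpdmf_mulmx A x = gpdmf_mulmx A y -> x = y.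
  move=> /eqP rA /gpdmf_mulmx_eqE; rewrite gpdmf_coords_mulmx.
  by move=> /(row_full_inj rA)/(can_inj (@gpdmf_coordsK R n)).
split=> //.
  split=> [[x [Ax x0]]|/(@rank_lt_mulmx0 _ _ _ 4)[K AK K0]].
    rewrite ltn_neqAle rank_leq_col andbT; apply/eqP => rA.
    by apply: x0; apply: (uniqA _ _ rA); rewrite Ax A0.
  exists (gpdmf_of_coords K); split.
    by apply/gpdmf_mulmx_eqE; rewrite gpdmf_of_coordsK gpdmf_coords0.
  move=> /(congr1 (@gpdmf_coords R n)); rewrite gpdmf_of_coordsK gpdmf_coords0.
  exact/eqP.
move=> b; split.
- rewrite -mulmx_solvableP; split=> -[x].
    by move=> /gpdmf_mulmx_eqE <-; exists (gpdmf_coords x).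
  by exists (gpdmf_of_coords x); apply/gpdmf_mulmx_eqE; rewrite gpdmf_of_coordsK.
- move=> [x Ax] rA; exists x; split=> // y Ay.
  by apply: (uniqA _ _ rA); rewrite Ax Ay.
- move=> [x /gpdmf_mulmx_eqE Ax] /(@rank_lt_mulmx0 _ _ _ 4)[K AK K0] fin.
  pose f (t : nat) := gpdmf_of_coords (gpdmf_coords x + t%:R *: K).
  have f_inj : injective f.
    move=> s t /(can_inj (@gpdmf_of_coordsK R n))/addrI/eqP.
    rewrite -subr_eq0 -scalerBl scaler_eq0 (negbTE K0) orbF subr_eq0 eqr_nat.
    by move=> /eqP.
  have f_sol t : gpdmf_mulmx A (f t) = b.
    apply/gpdmf_mulmx_eqE; rewrite gpdmf_of_coordsK mulmxDr Ax.
    by rewrite -scalemxAr AK scaler0 addr0.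
  apply: infinite_nat; apply: sub_finite_set (finite_preimage _ fin).
    by move=> t _; exact: f_sol.
  by move=> s t _ _; exact: f_inj.
Qed.
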